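(* For any local real analytic CR-generic submanifold $M^5\subset\mathbb C^4$ which is represented near the origin as a graph $v_j=\varphi_j(x,y,u_1,u_2,u_3)$, $j=1,2,3$, in coordinates $(z,w_1,w_2,w_3)=(x+iy,u_1+iv_1,u_2+iv_2,u_3+iv_3)$, the bundle $T^{0,1}M$ is generated by $$\overline{\mathcal L}=\frac{\partial}{\partial\overline z}+\mathsf A_1\frac{\partial}{\partial\overline w_1}+\mathsf A_2\frac{\partial}{\partial\overline w_2}+\mathsf A_3\frac{\partial}{\partial\overline w_3},\qquad \mathsf A_j=\frac{\Lambda^j_1}{\Delta}+i\,\frac{\Lambda^j_2}{\Delta},$$ where $\Delta=\sigma^2+\tau^2$ with $$\sigma=\varphi_{3u_3}+\varphi_{1u_1}+\varphi_{2u_2}-\varphi_{1u_2}\varphi_{3u_1}\varphi_{2u_3}-\varphi_{1u_3}\varphi_{2u_1}\varphi_{3u_2}+\varphi_{1u_2}\varphi_{2u_1}\varphi_{3u_3}-\varphi_{1u_1}\varphi_{2u_2}\varphi_{3u_3}+\varphi_{1u_1}\varphi_{2u_3}\varphi_{3u_2}+\varphi_{1u_3}\varphi_{3u_1}\varphi_{2u_2},$$ $$\tau=-1+\varphi_{1u_1}\varphi_{2u_2}-\varphi_{2u_3}\varphi_{3u_2}-\varphi_{1u_3}\varphi_{3u_1}+\varphi_{2u_2}\varphi_{3u_3}-\varphi_{1u_2}\varphi_{2u_1}+\varphi_{1u_1}\varphi_{3u_3},$$ and where, for $j=1,2,3$, $\Lambda^j_1=X_j\,\sigma+Y_j\,\tau$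 and $\Lambda^j_2=Y_j\,\sigma-X_j\,\tau$ with $$X_1=-\varphi_{3u_3}\varphi_{2x}\varphi_{1u_2}-\varphi_{1u_3}\varphi_{3y}+\varphi_{2u_2}\varphi_{1x}\varphi_{3u_3}+\varphi_{3u_3}\varphi_{1y}-\varphi_{1x}-\varphi_{2y}\varphi_{1u_2}+\varphi_{2u_3}\varphi_{3x}\varphi_{1u_2}+\varphi_{2u_2}\varphi_{1y}-\varphi_{2u_3}\varphi_{3u_2}\varphi_{1x}-\varphi_{2u_2}\varphi_{1u_3}\varphi_{3x}+\varphi_{2x}\varphi_{1u_3}\varphi_{3u_2},$$ $$Y_1=\varphi_{1u_3}\varphi_{3x}-\varphi_{1y}+\varphi_{2x}\varphi_{1u_2}+\varphi_{2u_3}\varphi_{1u_2}\varphi_{3y}-\varphi_{2u_2}\varphi_{1x}-\varphi_{2u_3}\varphi_{3u_2}\varphi_{1y}-\varphi_{3u_3}\varphi_{1x}-\varphi_{2u_2}\varphi_{1u_3}\varphi_{3y}-\varphi_{3u_3}\varphi_{1u_2}\varphi_{2y}+\varphi_{1u_3}\varphi_{3u_2}\varphi_{2y}+\varphi_{2u_2}\varphi_{3u_3}\varphi_{1y},$$ $$X_2=-\varphi_{2x}+\varphi_{3u_3}\varphi_{2y}+\varphi_{1u_3}\varphi_{2u_1}\varphi_{3x}-\varphi_{2u_3}\varphi_{3y}-\varphi_{1u_3}\varphi_{3u_1}\varphi_{2x}-\varphi_{2u_1}\varphi_{1y}-\varphi_{2u_1}\varphi_{3u_3}\varphi_{1x}+\varphi_{1u_1}\varphi_{2y}-\varphi_{1u_1}\varphi_{2u_3}\varphi_{3x}+\varphi_{3u_1}\varphi_{2u_3}\varphi_{1x}+\varphi_{1u_1}\varphi_{3u_3}\varphi_{2x},$$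 $$Y_2=-\varphi_{1u_1}\varphi_{2u_3}\varphi_{3y}+\varphi_{1u_3}\varphi_{2u_1}\varphi_{3y}-\varphi_{1u_3}\varphi_{3u_1}\varphi_{2y}+\varphi_{3u_1}\varphi_{2u_3}\varphi_{1y}+\varphi_{2u_3}\varphi_{3x}-\varphi_{2u_1}\varphi_{3u_3}\varphi_{1y}-\varphi_{3u_3}\varphi_{2x}+\varphi_{1u_1}\varphi_{3u_3}\varphi_{2y}+\varphi_{2u_1}\varphi_{1x}-\varphi_{1u_1}\varphi_{2x}-\varphi_{2y},$$ $$X_3=-\varphi_{2u_1}\varphi_{1u_2}\varphi_{3x}-\varphi_{3u_1}\varphi_{1y}+\varphi_{2u_1}\varphi_{3u_2}\varphi_{1x}+\varphi_{1u_1}\varphi_{3y}-\varphi_{3u_1}\varphi_{2u_2}\varphi_{1x}-\varphi_{3u_2}\varphi_{2y}+\varphi_{3u_1}\varphi_{1u_2}\varphi_{2x}+\varphi_{2u_2}\varphi_{3y}-\varphi_{3u_2}\varphi_{1u_1}\varphi_{2x}+\varphi_{1u_1}\varphi_{2u_2}\varphi_{3x}-\varphi_{3x},$$ $$Y_3=-\varphi_{3u_2}\varphi_{1u_1}\varphi_{2y}+\varphi_{2u_1}\varphi_{3u_2}\varphi_{1y}+\varphi_{3u_1}\varphi_{1x}+\varphi_{3u_1}\varphi_{1u_2}\varphi_{2y}-\varphi_{2u_1}\varphi_{1u_2}\varphi_{3y}+\varphi_{3u_2}\varphi_{2x}-\varphi_{1u_1}\varphi_{3x}-\varphi_{3u_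1}\varphi_{2u_2}\varphi_{1y}+\varphi_{1u_1}\varphi_{2u_2}\varphi_{3y}-\varphi_{3y}-\varphi_{2u_2}\varphi_{3x}.$$
   Context: The graphing functions $\varphi_1,\varphi_2,\varphi_3$ are real analytic near the origin with $\varphi_j(0)=0$ and $d\varphi_j(0)=0$. Lower indices denote partial derivatives, e.g. $\varphi_{1u_2}=\partial\varphi_1/\partial u_2$, $\varphi_{3x}=\partial\varphi_3/\partial x$. $T^{0,1}M=T^{0,1}\mathbb C^4\cap(\mathbb C\otimes_{\mathbb R}TM)$; it has complex rank $1$. *)

(* Defs.v *)
From HB Require Import structures.
From mathcomp Require Import all_boot all_order all_algebra.
From mathcomp Require Import all_classical all_reals all_analysis.
From mathcomp Require Import complex.

Set Implicit Arguments.
Unset Strict Implicit.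
Unset Printing Implicit Defensive.

Import Order.TTheory GRing.Theory Num.Theory.
Import numFieldNormedType.Exports.

Local Open Scope classical_set_scope.
Local Open Scope complex_scope.
Local Open Scope ring_scope.

(* f is the sum, on a ball around a, of an absolutely convergent power series
   sum_alpha c_alpha (q - a)^alpha over all multi-indices alpha.  The sums are
   taken along the exhausting boxes {0, ..., N-1}^n; by absolute convergence
   the order of summation is irrelevant. *)
Definition analytic_at (R : realType) (n : nat) (f : 'rV[R]_n -> R)
    (a : 'rV[R]_n) : Prop :=
  exists (c : ('I_n -> nat) -> R) (r : R), 0 < r /\
    forall h : 'rV[R]_n, `|h| < r ->
      let term (alpha : 'I_n -> nat) :=
        c alpha * \prod_(i < n) h 0 i ^+ alpha i in
      cvgn (fun N : nat =>
        \sum_(alpha : {ffun 'I_n -> 'I_N}) `|term (fun i => alpha i)|) /\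
      (\sum_(alpha : {ffun 'I_n -> 'I_N}) term (fun i => alpha i))
        @[N --> \oo] --> f (a + h).

Definition analytic_near (R : realType) (n : nat) (f : 'rV[R]_n -> R)
    (a : 'rV[R]_n) : Prop :=
  \forall q \near a, analytic_at f q.

(* Real analytic submanifold of codimension d: locally the common zero set of
   d analytic functions whose differentials are linearly independent. *)
Definition analytic_submanifold (R : realType) (n d : nat)
    (M : set 'rV[R]_n) : Prop :=
  forall p, M p -> exists rho : 'I_d -> 'rV[R]_n -> R,
    [/\ forall j, analytic_near (rho j) p,
        \forall q \near p, M q <-> forall j, rho j q = 0
      & forall c : 'I_d -> R,
          (forall v, \sum_(j < d) c j * 'd (rho j) p v = 0) ->
          forall j, c j = 0].

(* Tangent vectors as velocities of curves in M. *)
Definition tangent (R : realType) (n : nat) (M : set 'rV[R]_n)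
    (p : 'rV[R]_n) : set 'rV[R]_n :=
  [set v | exists gamma : R -> 'rV[R]_n,
     [/\ gamma 0 = p, \forall t \near (0 : R), M (gamma t)
       & is_derive (0 : R) (1 : R) gamma v]].

(* Real coordinates on C^n: row_mx a b stands for the point a + i b, so the
   left block holds the real parts and the right block the imaginary parts. *)
Definition complex_pt (R : realType) (n : nat) (q : 'rV[R]_(n + n)) :
    'rV[R[i]]_n :=
  \row_k (lsubmx q 0 k +i* rsubmx q 0 k).

Definition realify (R : realType) (n : nat) (M : set 'rV[R[i]]_n) :
    set 'rV[R]_(n + n) :=
  [set q | M (complex_pt q)].

(* The standard complex structure: J(a + i b) = - b + i a. *)
Definition Jstd (R : realType) (n : nat) (v : 'rV[R]_(n + n)) :
    'rV[R]_(n + n) :=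
  row_mx (- rsubmx v) (lsubmx v).

(* T_pM + J(T_pM) = T_pC^n at every point of M. *)
Definition CR_generic (R : realType) (n : nat) (M : set 'rV[R]_(n + n)) :
    Prop :=
  forall p, M p -> forall w, exists a b,
    [/\ tangent M p a, tangent M p b & w = a + Jstd b].

(* C (x)_R T_pM inside C (x)_R T_pC^n = C^(2n). *)
Definition ctangent (R : realType) (n : nat) (M : set 'rV[R]_n)
    (p : 'rV[R]_n) : set 'rV[R[i]]_n :=
  [set V | exists a b, [/\ tangent M p a, tangent M p b
     & V = map_mx (real_complex R) a + 'i *: map_mx (real_complex R) b]].

(* d/d(zbar_k) = (d/dx_k + i d/dy_k) / 2. *)
Definition dbar (R : realType) (n : nat) (k : 'I_n) : 'rV[R[i]]_(n + n) :=
  2^-1 *: (row_mx (delta_mx 0 k) 0 + 'i *: row_mx 0 (delta_mx 0 k)).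

Definition T01_space (R : realType) (n : nat) : set 'rV[R[i]]_(n + n) :=
  [set V | exists c : 'I_n -> R[i], V = \sum_(k < n) c k *: dbar R k].
Arguments T01_space : clear implicits.

Definition T01 (R : realType) (n : nat) (M : set 'rV[R]_(n + n))
    (p : 'rV[R]_(n + n)) : set 'rV[R[i]]_(n + n) :=
  T01_space R n `&` ctangent M p.

(* Coordinates (z, w_1, w_2, w_3) = (x + i y, u_1 + i v_1, ...) on C^4; the
   index j : 'I_3 = {0, 1, 2} stands for the subscript j + 1. *)
Definition xcoord (R : realType) (q : 'rV[R]_(4 + 4)) : R := lsubmx q 0 ord0.
Definition ycoord (R : realType) (q : 'rV[R]_(4 + 4)) : R := rsubmx q 0 ord0.
Definition ucoord (R : realType) (q : 'rV[R]_(4 + 4)) (j : 'I_3) : R :=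
  lsubmx q 0 (lift ord0 j).
Definition vcoord (R : realType) (q : 'rV[R]_(4 + 4)) (j : 'I_3) : R :=
  rsubmx q 0 (lift ord0 j).

Definition base_pt (R : realType) (q : 'rV[R]_(4 + 4)) : 'rV[R]_5 :=
  \row_(i < 5) [:: xcoord q; ycoord q; ucoord q 0; ucoord q 1; ucoord q 2]`_i.

Section Coefficients.
Variables (R : realType) (phi : 'I_3 -> 'rV[R]_5 -> R) (p : 'rV[R]_5).

Definition partial (j : 'I_3) (k : 'I_5) : R :=
  'D_(delta_mx 0 k : 'rV[R]_5) (phi j) p.

Local Notation f1x := (partial 0 0).
Local Notation f1y := (partial 0 1).
Local Notation f1u1 := (partial 0 2).
Local Notation f1u2 := (partial 0 3).
Local Notation f1u3 := (partial 0 4).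
Local Notation f2x := (partial 1 0).
Local Notation f2y := (partial 1 1).
Local Notation f2u1 := (partial 1 2).
Local Notation f2u2 := (partial 1 3).
Local Notation f2u3 := (partial 1 4).
Local Notation f3x := (partial 2 0).
Local Notation f3y := (partial 2 1).
Local Notation f3u1 := (partial 2 2).
Local Notation f3u2 := (partial 2 3).
Local Notation f3u3 := (partial 2 4).

Definition sigma : R :=
  f3u3 + f1u1 + f2u2 - f1u2 * f3u1 * f2u3 - f1u3 * f2u1 * f3u2
  + f1u2 * f2u1 * f3u3 - f1u1 * f2u2 * f3u3 + f1u1 * f2u3 * f3u2
  + f1u3 * f3u1 * f2u2.

Definition tau : R :=
  -1 + f1u1 * f2u2 - f2u3 * f3u2 - f1u3 * f3u1 + f2u2 * f3u3
  - f1u2 * f2u1 + f1u1 * f3u3.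

Definition Delta : R := sigma ^+ 2 + tau ^+ 2.

Definition X1 : R :=
  - f3u3 * f2x * f1u2 - f1u3 * f3y + f2u2 * f1x * f3u3 + f3u3 * f1y - f1x
  - f2y * f1u2 + f2u3 * f3x * f1u2 + f2u2 * f1y - f2u3 * f3u2 * f1x
  - f2u2 * f1u3 * f3x + f2x * f1u3 * f3u2.

Definition Y1 : R :=
  f1u3 * f3x - f1y + f2x * f1u2 + f2u3 * f1u2 * f3y - f2u2 * f1x
  - f2u3 * f3u2 * f1y - f3u3 * f1x - f2u2 * f1u3 * f3y - f3u3 * f1u2 * f2y
  + f1u3 * f3u2 * f2y + f2u2 * f3u3 * f1y.

Definition X2 : R :=
  - f2x + f3u3 * f2y + f1u3 * f2u1 * f3x - f2u3 * f3y - f1u3 * f3u1 * f2x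
  - f2u1 * f1y - f2u1 * f3u3 * f1x + f1u1 * f2y - f1u1 * f2u3 * f3x
  + f3u1 * f2u3 * f1x + f1u1 * f3u3 * f2x.

Definition Y2 : R :=
  - f1u1 * f2u3 * f3y + f1u3 * f2u1 * f3y - f1u3 * f3u1 * f2y
  + f3u1 * f2u3 * f1y + f2u3 * f3x - f2u1 * f3u3 * f1y - f3u3 * f2x
  + f1u1 * f3u3 * f2y + f2u1 * f1x - f1u1 * f2x - f2y.

Definition X3 : R :=
  - f2u1 * f1u2 * f3x - f3u1 * f1y + f2u1 * f3u2 * f1x + f1u1 * f3y
  - f3u1 * f2u2 * f1x - f3u2 * f2y + f3u1 * f1u2 * f2x + f2u2 * f3y
  - f3u2 * f1u1 * f2x + f1u1 * f2u2 * f3x - f3x.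

Definition Y3 : R :=
  - f3u2 * f1u1 * f2y + f2u1 * f3u2 * f1y + f3u1 * f1x + f3u1 * f1u2 * f2y
  - f2u1 * f1u2 * f3y + f3u2 * f2x - f1u1 * f3x - f3u1 * f2u2 * f1y
  + f1u1 * f2u2 * f3y - f3y - f2u2 * f3x.

Definition X (j : 'I_3) : R := [:: X1; X2; X3]`_j.
Definition Y (j : 'I_3) : R := [:: Y1; Y2; Y3]`_j.

Definition Lambda1 (j : 'I_3) : R := X j * sigma + Y j * tau.
Definition Lambda2 (j : 'I_3) : R := Y j * sigma - X j * tau.

Definition Acoef (j : 'I_3) : R[i] :=
  (Lambda1 j / Delta)%:C + 'i * (Lambda2 j / Delta)%:C.

Definition Lbar : 'rV[R[i]]_(4 + 4) :=
  dbar R (ord0 : 'I_4)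
  + \sum_(j < 3) Acoef j *: dbar R (lift ord0 j : 'I_4).

End Coefficients.

(* Main.v *)
(* Near a point where it is analytic, a function is strictly differentiable:
   the increments of the monomials of degree at least 2 of its power series are
   bounded, after summation by absolute convergence, by K rho |h - k| on the
   ball of radius rho.  Hence the phi_j are differentiable near 0 and their
   partial derivatives are continuous at 0, where they vanish; so tau tends to
   -1 and Delta does not vanish near 0.

   By the chain rule the tangent space of the graph is the set of vectors with
   dv_j = dphi_j(dx, dy, du).  Writing Phi for the matrix of the phi_{j u_k} and
   g_j = phi_{jx} + i phi_{jy}, a vector sum_k c_k d/d(zbar_k), with coefficients
   c_0 and c' = (c_1, c_2, c_3), is then tangent iff (i I - Phi) c' = c_0 g.
   Since det (i I - Phi) = sigma + i tau and adj (i I - Phi) g = X + i Y, Cramer's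
   rule gives c' = c_0 A with A = (X + i Y) / (sigma + i tau). *)
Require Import Defs.
From HB Require Import structures.
From mathcomp Require Import all_boot all_order all_algebra.
From mathcomp Require Import all_classical all_reals all_analysis.
From mathcomp Require Import complex.
From mathcomp Require Import ring lra.
Import Order.TTheory GRing.Theory Num.Theory.
Import numFieldNormedType.Exports.
Local Open Scope classical_set_scope.
Local Open Scope ring_scope.

(** * Increments of monomials *)

(** Mean value bounds [m * rho ^ (m - 1) * d] are stable under products: in
    [a a' - b b' = a (a' - b') + (a - b) b'] the degrees add. The truncated predecessor is harmless
    in degree 0, where the factor [m] vanishes. *)
Lemma ler_dist_mul_deg {R : realFieldType} (rho d a b a' b' : R) (m n : nat) :
  `|a| <= rho ^+ m -> `|b'| <= rho ^+ n ->
  `|a - b| <= m%:R * rho ^+ m.-1 * d -> `|a' - b'| <= n%:R * rho ^+ n.-1 * d ->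
  0 <= rho ->
  `|a * a' - b * b'| <= (m + n)%:R * rho ^+ (m + n).-1 * d.
Proof.
move=> ha hb' hab hab' rho0.
have -> : a * a' - b * b' = a * (a' - b') + (a - b) * b' by ring.
apply: (le_trans (ler_normD _ _)); rewrite !normrM.
have -> : (m + n)%:R * rho ^+ (m + n).-1 * d =
    rho ^+ m * (n%:R * rho ^+ n.-1 * d) + m%:R * rho ^+ m.-1 * d * rho ^+ n.
  case: m {ha hab} => [|m]; case: n {hb' hab'} => [|n] /=;
    rewrite ?addn0 ?add0n ?expr0 ?mul0r ?mulr0 ?addr0 ?mul0r ?add0r ?mul1r ?mulr1 //.
  by rewrite natrD addnS !exprS exprD; ring.
by apply: lerD; apply: ler_pM.
Qed.

Lemma ler_norm_monomial {R : realFieldType} {n : nat} (rho : R) (h : 'I_n -> R)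
    (alpha : 'I_n -> nat) (s : seq 'I_n) :
  (forall i, `|h i| <= rho) ->
  `|\prod_(i <- s) h i ^+ alpha i| <= rho ^+ (\sum_(i <- s) alpha i).
Proof.
move=> hrho; elim: s => [|i s IH]; first by rewrite !big_nil expr0 normr1.
rewrite !big_cons normrM exprD ler_pM // normrX.
by rewrite lerXn2r ?nnegrE // (le_trans _ (hrho i)).
Qed.

(** Induction over the variables, and over the exponent of each, with [ler_dist_mul_deg] at both
    levels. *)
Lemma ler_dist_monomial {R : realFieldType} {n : nat} (rho d : R)
    (h k : 'I_n -> R) (alpha : 'I_n -> nat) (s : seq 'I_n) :
  0 <= rho -> (forall i, `|h i| <= rho) -> (forall i, `|k i| <= rho) ->
  (forall i, `|h i - k i| <= d) ->
  `|\prod_(i <- s) h i ^+ alpha i - \prod_(i <- s) k i ^+ alpha i| <=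
  (\sum_(i <- s) alpha i)%:R * rho ^+ (\sum_(i <- s) alpha i).-1 * d.
Proof.
move=> rho0 hrho krho hk.
have powle x m : `|x| <= rho -> `|x ^+ m| <= rho ^+ m.
  by move=> xrho; rewrite normrX lerXn2r ?nnegrE.
elim: s => [|i s IH]; first by rewrite !big_nil subrr normr0 !mul0r.
rewrite !big_cons; apply: ler_dist_mul_deg => //; first exact: powle.
  exact: ler_norm_monomial.
elim: (alpha i) => [|m IHm]; first by rewrite !expr0 subrr normr0 !mul0r.
rewrite !exprS -add1n; apply: ler_dist_mul_deg; rewrite ?expr1 ?powle //.
by rewrite expr0 !mul1r.
Qed.

(** * Linear terms of a power series *)

Definition multi1 {n : nat} (i : 'I_n) (j : 'I_n) : nat := (j == i).

Definition is_multi1 {n : nat} (i : 'I_n) (alpha : 'I_n -> nat) : bool :=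
  [forall j, alpha j == multi1 i j].

(** At most one index contributes, and none unless [alpha] has degree 1. The form as a sum allows an
    exchange with the sum over [alpha]. *)
Definition linear_part {R : realFieldType} {n : nat} (h : 'rV[R]_n)
    (alpha : 'I_n -> nat) : R :=
  \sum_(i < n | is_multi1 i alpha) h 0 i.

Lemma is_multi1P {n : nat} (i : 'I_n) (alpha : 'I_n -> nat) :
  reflect (alpha = multi1 i) (is_multi1 i alpha).
Proof.
apply: (iffP forallP) => [H|-> //]; apply/funext => j; exact/eqP.
Qed.

Lemma sum_multi1 {n : nat} (i : 'I_n) : (\sum_(j < n) multi1 i j = 1)%N.
Proof.
rewrite (bigD1 i) //= /multi1 eqxx big1 // => j /negbTE -> //.
Qed.

Lemma linear_part_multi1 {R : realFieldType} {n : nat} (i : 'I_n)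
    (h : 'rV[R]_n) : linear_part h (multi1 i) = h 0 i.
Proof.
rewrite /linear_part (big_pred1 i) // => j.
apply/is_multi1P/eqP => [/(congr1 (@^~ j))|-> //].
by rewrite /multi1 eqxx; case: eqP.
Qed.

Lemma monomial_multi1 {R : realFieldType} {n : nat} (i : 'I_n)
    (h : 'rV[R]_n) : \prod_(j < n) h 0 j ^+ multi1 i j = h 0 i.
Proof.
rewrite (bigD1 i) //= /multi1 eqxx expr1 big1 ?mulr1 // => j /negbTE ->.
by rewrite expr0.
Qed.

Lemma linear_part0 {R : realFieldType} {n : nat} (alpha : 'I_n -> nat)
    (h : 'rV[R]_n) :
  (\sum_(i < n) alpha i != 1)%N -> linear_part h alpha = 0.
Proof.
move=> deg; rewrite /linear_part big_pred0 // => i; apply/is_multi1P => E.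
by move: deg; rewrite E sum_multi1.
Qed.

Lemma degree_eq1 {n : nat} (alpha : 'I_n -> nat) :
  (\sum_(i < n) alpha i = 1)%N -> exists i, alpha = multi1 i.
Proof.
move=> deg.
have [i ai] : exists i, alpha i != 0%N.
  apply/existsP; apply: contra_eqT deg; rewrite negb_exists => /forallP H.
  by rewrite big1 // => i _; apply/eqP; have := H i; rewrite negbK.
exists i; move: deg; rewrite (bigD1 i) //= => deg.
have ai1 : alpha i = 1%N.
  by move: deg ai; case: (alpha i) => // -[|k] //; rewrite addSn.
move: deg; rewrite ai1 => -[] /eqP; rewrite sum_nat_eq0 => /forallP H.
apply/funext => j; rewrite /multi1; case: eqP => [-> //|/eqP ji].
by apply/eqP; have := H j; rewrite ji.
Qed.

(* The factor [4 / s ^+ 2] comes from [m <= 2 ^ m] and [rho / s <= 1 / 2]. *)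
Lemma ler_monomial_remainder {R : realFieldType} {n : nat} (rho s : R)
    (h k : 'rV[R]_n) (alpha : 'I_n -> nat) :
  0 < s -> rho <= s / 2 ->
  (forall i, `|h 0 i| <= rho) -> (forall i, `|k 0 i| <= rho) -> 0 <= rho ->
  forall d : R, (forall i, `|h 0 i - k 0 i| <= d) -> 0 <= d ->
  `|\prod_(i < n) h 0 i ^+ alpha i - \prod_(i < n) k 0 i ^+ alpha i
    - linear_part (h - k) alpha| <=
  4 / s ^+ 2 * rho * d * s ^+ (\sum_(i < n) alpha i).
Proof.
move=> s0 rhos hrho krho rho0 d hk d0.
have rhs0 m : 0 <= 4 / s ^+ 2 * rho * d * s ^+ m.
  by rewrite !mulr_ge0 ?exprn_ge0 ?invr_ge0 ?exprn_ge0 // ltW.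
have := ler_dist_monomial _ _ _ _ alpha (index_enum _) rho0 hrho krho hk.
have [deg1|deg1] := eqVneq (\sum_(i < n) alpha i)%N 1%N.
  have [i ->] := degree_eq1 _ deg1.
  by rewrite !monomial_multi1 linear_part_multi1 !mxE subrr normr0.
rewrite linear_part0 // subr0 => /le_trans; apply.
case: (\sum_(i < n) alpha i)%N deg1 => [|[//|m]] _.
  by rewrite !mul0r.
rewrite /= exprS.
have -> : m.+2%:R * (rho * rho ^+ m) * d = rho * d * (m.+2%:R * rho ^+ m) by ring.
have -> : 4 / s ^+ 2 * rho * d * s ^+ m.+2 = rho * d * (4 * s ^+ m).
  by rewrite !exprS; field; lra.
apply: ler_wpM2l; first exact: mulr_ge0.
have : rho ^+ m <= (s / 2) ^+ m by rewrite lerXn2r ?nnegrE // divr_ge0 // ltW.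
move/(ler_wpM2l (ler0n R m.+2)) => /le_trans; apply.
rewrite expr_div_n mulrA ler_pdivrMr ?exprn_gt0 //.
rewrite mulrAC ler_wpM2r ?exprn_ge0 ?(ltW s0) //.
have -> : 4 * 2 ^+ m = (2 ^ m.+2)%:R :> R by rewrite natrX !exprS; ring.
by rewrite ler_nat ltnW // ltn_expl.
Qed.

(** For [1 < N] the box contains every multi-index of degree 1, whose entries are 0 or 1. *)
Lemma sum_linear_part {R : realFieldType} {n : nat} (N : nat)
    (c : ('I_n -> nat) -> R) (v : 'rV[R]_n) : (1 < N)%N ->
  \sum_(alpha : {ffun 'I_n -> 'I_N}) c (fun i => alpha i) *
    linear_part v (fun i => alpha i) = \sum_(i < n) c (multi1 i) * v 0 i.
Proof.
case: N => // N N1; under eq_bigr do rewrite mulr_sumr big_mkcond /=.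
rewrite exchange_big; apply: eq_bigr => i _; rewrite -big_mkcond /=.
have inordE j : (inord (multi1 i j) : 'I_N.+1) = multi1 i j :> nat.
  by apply: inordK; exact: leq_ltn_trans (leq_b1 _) N1.
rewrite (big_pred1 [ffun j => inord (multi1 i j) : 'I_N.+1]) => [|alpha].
  congr (c _ * _); apply/funext => j; rewrite ffunE; exact: inordE.
apply/is_multi1P/eqP => [E|->].
  by apply/ffunP => j; apply: val_inj; rewrite ffunE /= inordE -E.
by apply/funext => j; rewrite ffunE; exact: inordE.
Qed.

(** * Strict differentiability of analytic functions *)

Lemma ler_coord_norm {R : realFieldType} {m n : nat} (A : 'M[R]_(m, n)) i j :
  `|A i j| <= `|A|.
Proof.
rewrite [leRHS]/Num.Def.normr /= mx_normrE.
exact: (le_bigmax _ (fun ij : 'I_m * 'I_n => `|A ij.1 ij.2|) (i, j)).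
Qed.

(** Once the linear terms are removed, [ler_monomial_remainder] bounds each difference of monomials
    by a multiple of [s] to the degree, summable against [|c alpha|]. As [K] does not depend on the
    box, the bound passes to the limit. *)
Lemma analytic_at_strict_diff {R : realType} {n : nat} (f : 'rV[R]_n -> R)
    (a : 'rV[R]_n) : analytic_at f a ->
  exists (l : 'I_n -> R) (K r : R), [/\ 0 <= K, 0 < r &
    forall (rho : R) (h k : 'rV[R]_n), rho <= r -> `|h| <= rho -> `|k| <= rho ->
    `|f (a + h) - f (a + k) - \sum_(i < n) l i * (h - k) 0 i| <=
    K * rho * `|h - k|].
Proof.
move=> [c [r [r0 /= ser]]].
(* The series converges absolutely at the constant vector [s], inside the ball; [h] and [k] are
   confined to radius [s / 2], where [rho / s <= 1 / 2]. *)
pose s := r / 2; have s0 : 0 < s by rewrite divr_gt0.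
have sr : s < r by rewrite /s; lra.
have : `|const_mx s : 'rV[R]_n| < r.
  rewrite [ltLHS]/Num.Def.normr /= mx_normrE (le_lt_trans _ sr) //.
  by apply: bigmax_le => [|ij _]; rewrite ?mxE ?ger0_norm ?(ltW s0).
move=> /ser[/cvg_ex[S /= cvgS] _].
pose B := `|S| + 1; have B0 : 0 <= B by rewrite addr_ge0.
exists (fun i => c (multi1 i)), (4 / s ^+ 2 * B), (s / 2); split.
- by rewrite !mulr_ge0 // ?invr_ge0 ?exprn_ge0 // ltW.
- by rewrite divr_gt0.
move=> rho h k rhos hrho krho.
have rho0 : 0 <= rho by rewrite (le_trans _ hrho).
have rhor : rho < r by apply: le_lt_trans rhos _; rewrite /s; lra.
pose P (v : 'rV[R]_n) (N : nat) := \sum_(alpha : {ffun 'I_n -> 'I_N})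
  c (fun i => alpha i) * \prod_(i < n) v 0 i ^+ alpha i.
have [_ cvgh] : _ /\ P h @ \oo --> f (a + h) := ser h (le_lt_trans hrho rhor).
have [_ cvgk] : _ /\ P k @ \oo --> f (a + k) := ser k (le_lt_trans krho rhor).
have cvghk : `|P h N - P k N - \sum_(i < n) c (multi1 i) * (h - k) 0 i|
    @[N --> \oo] -->
    `|f (a + h) - f (a + k) - \sum_(i < n) c (multi1 i) * (h - k) 0 i|.
  by apply: cvg_norm; apply: cvgB; [exact: cvgB|exact: cvg_cst].
apply: (cvgr_to_le cvghk).
have SB : S < B by rewrite /B (le_lt_trans (ler_norm S)) // ltrDl.
near=> N.
rewrite -(@sum_linear_part _ _ N); last by near: N; exact: nbhs_infty_gt.
rewrite -!sumrB (le_trans (ler_norm_sum _ _ _)) //.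
have : \sum_(alpha : {ffun 'I_n -> 'I_N})
   `|c (fun i => alpha i) *
     \prod_(i < n) (const_mx s : 'rV_n) 0 i ^+ alpha i| <= B.
  by near: N; exact: (cvgr_le _ cvgS).
have C0 : 0 <= 4 / s ^+ 2 * rho * `|h - k|.
  by rewrite !mulr_ge0 // ?invr_ge0 ?exprn_ge0 // ltW.
move=> /(ler_wpM2l C0); rewrite mulr_sumr.
have -> : 4 / s ^+ 2 * rho * `|h - k| * B = 4 / s ^+ 2 * B * rho * `|h - k|.
  by ring.
apply: le_trans; apply: ler_sum => alpha _.
rewrite -!mulrBr !normrM mulrCA ler_wpM2l //.
under [X in _ <= _ * `|X|]eq_bigr do rewrite mxE.
rewrite -expr_sum (ger0_norm (exprn_ge0 _ (ltW s0))).
apply: ler_monomial_remainder => // i.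
- exact: le_trans (ler_coord_norm _ _ _) hrho.
- exact: le_trans (ler_coord_norm _ _ _) krho.
- by have := ler_coord_norm (h - k) 0 i; rewrite !mxE.
Unshelve. all: by end_near. Qed.

(** With [k = 0] and [rho = |h|] the strict estimate reads [K |h| ^ 2], hence [o(h)], and uniqueness
    identifies the linear form with ['d f a]. *)
Lemma analytic_at_differentiable {R : realType} {n : nat} {f : 'rV[R]_n -> R}
    {a : 'rV[R]_n} : analytic_at f a ->
  differentiable f a /\
  exists K r : R, [/\ 0 <= K, 0 < r &
    forall (rho : R) (h k : 'rV[R]_n), rho <= r -> `|h| <= rho -> `|k| <= rho ->
    `|f (a + h) - f (a + k) - 'd f a (h - k)| <= K * rho * `|h - k|].
Proof.
move=> /analytic_at_strict_diff[l [K [r [K0 r0 strict]]]].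
pose L (v : 'rV[R]_n) : R := \sum_(i < n) l i * v 0 i.
have L_lin : linear L.
  move=> c u v; rewrite /L scaler_sumr -big_split; apply: eq_bigr => i _ /=.
  by rewrite !mxE /GRing.scale /=; ring.
pose Lmixin := GRing.isLinear.Build _ _ _ _ _ L_lin.
pose Llin : {linear 'rV[R]_n -> R} := HB.pack L Lmixin.
have Lcont : continuous Llin.
  have coordc i : continuous (fun v : 'rV[R]_n => l i * v 0 i).
    move=> v; exact: (@cvgMl_tmp _ _ (nbhs v) _ (fun u : 'rV[R]_n => u 0 i) (l i)
      (v 0 i) (@coord_continuous R 1 n 0 i v)).
  by apply: continuous_big => //; exact: add_continuous.
have f_o : f \o shift a = cst (f a) + Llin +o_ (0 : 'rV[R]_n) id.
  apply/eqaddoP => e e0; near=> h.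
  have rho_small : K * `|h| <= e.
    (* The denominator [K + 1] covers [K = 0]. *)
    have hK : `|h| <= e / (K + 1).
      by near: h; apply: (@nbhs0_le _ 'rV[R]_n); rewrite divr_gt0 // ltr_wpDl.
    apply: le_trans (ler_wpM2l K0 hK) _.
    by rewrite mulrCA ger_pMr // ler_pdivrMr ?ltr_wpDl // mul1r lerDl.
  have := strict `|h| h 0 _ (lexx _) _; rewrite normr0 subr0 addr0 normr_ge0.
  have -> : (f \o shift a - (cst (f a) + Llin)) h =
      f (a + h) - f a - \sum_(i < n) l i * h 0 i.
    by rewrite -[LHS]/(f (h + a) - (f a + L h)) opprD addrA (addrC h).
  move=> le_h; apply: (le_trans (le_h _ isT)).
    by near: h; exact: (@nbhs0_le _ 'rV[R]_n).
  by rewrite ler_wpM2r.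
have dfE := diff_unique Lcont f_o.
split; first by apply/diff_locallyP; rewrite dfE.
by exists K, r; split => // rho h k; rewrite dfE; exact: strict.
Unshelve. all: by end_near. Qed.

(** By the strict estimate at [a], difference quotients of [f] at a nearby [q] differ from
    ['d f a v] by at most [K rho |v|]; the step then tends to 0. *)
Lemma analytic_near_derive_continuous {R : realType} {n : nat}
    {f : 'rV[R]_n -> R} {a : 'rV[R]_n} (v : 'rV[R]_n) : analytic_near f a ->
  'D_v f q @[q --> a] --> 'D_v f a.
Proof.
move=> f_an.
have [dfa [K [r [K0 r0 strict]]]] :=
  analytic_at_differentiable (nbhs_singleton f_an).
apply/(@cvgrPdist_le _ _ _ (nbhs a)) => e e0; rewrite deriveE //.
pose rho := Num.min r (e / (K * `|v| + 1)).
have Kv0 : 0 < K * `|v| + 1 by rewrite ltr_wpDl // mulr_ge0.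
have rho0 : 0 < rho by rewrite lt_min r0 divr_gt0.
have rho_e : K * rho * `|v| <= e.
  rewrite mulrAC; have : rho <= e / (K * `|v| + 1) by rewrite ge_min lexx orbT.
  move=> /(ler_wpM2l (mulr_ge0 K0 (normr_ge0 v))) /le_trans; apply.
  by rewrite mulrCA ger_pMr // ler_pdivrMr // mul1r lerDl.
near=> q.
have dfq : differentiable f q.
  by have /analytic_at_differentiable[] : analytic_at f q by near: q.
have qa : `|q - a| < rho.
  by rewrite distrC; near: q; exact: cvgr_dist_lt.
have dfv : (fun t : R => t^-1 *: ((f \o shift q) (t *: v) - f q)) @ 0^' -->
    'D_v f q := @diff_derivable _ _ _ f q v dfq.
have : (fun t : R => `|'d f a v - t^-1 *: ((f \o shift q) (t *: v) - f q)|) @ 0^' -->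
    `|'d f a v - 'D_v f q|.
  apply: cvg_norm; apply: cvgB; first exact: cvg_cst.
  exact: dfv.
move=> /cvgr_to_le; apply; near=> t.
have t0 : t != 0 by near: t; exact: nbhs_dnbhs_neq.
have tq : `|t *: v + q - a| <= rho.
  near: t; apply: nbhs_dnbhs.
  have : (`|t *: v + q - a|) @[t --> (0 : R)] --> `|0 *: v + q - a|.
    apply: cvg_norm; apply: cvgB; last exact: cvg_cst.
    apply: cvgD; last exact: cvg_cst.
    by apply: cvgZr_tmp; exact: cvg_id.
  rewrite scale0r add0r.
  by move=> /cvgr_le; apply.
(* Taken at [h = t v + q - a] and [k = q - a], so that [h - k = t v]. *)
have := strict rho _ _ _ tq (ltW qa).
rewrite !(addrC a) !subrK opprB addrA subrK addrK linearZ normrZ.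
rewrite ge_min lexx => /(_ isT) strict_t.
rewrite (le_trans _ rho_e) //= -(ler_pM2l (_ : 0 < `|t|)) ?normr_gt0 //.
rewrite mulrCA; apply: le_trans strict_t.
by rewrite -normrZ scalerBr scalerA divff // scale1r distrC.
Unshelve. all: by end_near. Qed.

(** * Tangent vectors of a graph *)

Lemma is_derive_mxP {R : realFieldType} {V : normedModType R} {m n : nat}
    (M : V -> 'M[R]_(m, n)) (t v : V) (dM : 'M[R]_(m, n)) :
  is_derive t v M dM <->
  forall i j, is_derive t v (fun x => M x i j) (dM i j).
Proof.
split=> [[Mtv <-] i j|Mtv].
  rewrite derive_mx // mxE; apply: DeriveDef => //.
  exact: (derivable_mxP _ _ _).1.
have dMtv : derivable M t v by apply/derivable_mxP => i j; exact: ex_derive.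
apply: DeriveDef => //; rewrite derive_mx //; apply/matrixP => i j.
by rewrite mxE derive_val.
Qed.

Lemma is_derive_comp_diff {R : realType} {V W : normedModType R} (f : V -> W)
    (c : R -> V) (t : R) (v : V) :
  is_derive t 1 c v -> differentiable f (c t) ->
  is_derive t 1 (f \o c) ('d f (c t) v).
Proof.
move=> [/derivable1_diffP dc <-] df.
have dfc : differentiable (f \o c) t by exact: differentiable_comp.
apply: DeriveDef; first exact/derivable1_diffP.
by rewrite deriveE // diff_comp //= deriveE.
Qed.

Lemma base_ptE {R : realType} (q : 'rV[R]_(4 + 4)) (i : 'I_5) :
  base_pt q 0 i =
  q 0 [:: lshift 4 ord0; rshift 4 ord0; lshift 4 (lift ord0 0);
          lshift 4 (lift ord0 1); lshift 4 (lift ord0 2%R)]`_i.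
Proof.
rewrite mxE; case: i => -[|[|[|[|[|]]]]] //= ?.
all: by rewrite /xcoord /ycoord /ucoord mxE.
Qed.

Lemma vcoordE {R : realType} (q : 'rV[R]_(4 + 4)) (j : 'I_3) :
  vcoord q j = q 0 (rshift 4 (lift ord0 j)).
Proof. by rewrite /vcoord mxE. Qed.

(** The projection onto the graph along the [v] directions; index [ord0] of the right block is [y],
    which is kept. *)
Definition graph_pt {R : realType} (phi : 'I_3 -> 'rV[R]_5 -> R)
    (q : 'rV[R]_(4 + 4)) : 'rV[R]_(4 + 4) :=
  row_mx (lsubmx q) (\row_k if unlift ord0 k is Some j then phi j (base_pt q)
                            else ycoord q).

Lemma vcoord_graph_pt {R : realType} (phi : 'I_3 -> 'rV[R]_5 -> R)
    (q : 'rV[R]_(4 + 4)) (j : 'I_3) :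
  vcoord (graph_pt phi q) j = phi j (base_pt q).
Proof. by rewrite /vcoord row_mxKr mxE liftK. Qed.

Lemma base_graph_pt {R : realType} (phi : 'I_3 -> 'rV[R]_5 -> R)
    (q : 'rV[R]_(4 + 4)) : base_pt (graph_pt phi q) = base_pt q.
Proof.
have yE : ycoord (graph_pt phi q) = ycoord q.
  by rewrite [LHS]/ycoord row_mxKr mxE unlift_none.
by rewrite /base_pt yE /xcoord /ucoord row_mxKl.
Qed.

Lemma graph_pt_id {R : realType} (phi : 'I_3 -> 'rV[R]_5 -> R)
    (q : 'rV[R]_(4 + 4)) :
  (forall j, vcoord q j = phi j (base_pt q)) -> graph_pt phi q = q.
Proof.
move=> q_graph; rewrite -[RHS]hsubmxK; congr row_mx; apply/rowP => k.
by rewrite mxE; case: unliftP => [j ->|->//]; rewrite -q_graph.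
Qed.

(** Differentiating [v_j = phi_j] along a curve in [M] gives one direction. For the converse, the
    line through [q] with direction [v] is projected onto the graph; the condition on [v] says that
    the velocity at 0 remains [v]. *)
Lemma tangent_graph {R : realType} (M : set 'rV[R]_(4 + 4))
    (phi : 'I_3 -> 'rV[R]_5 -> R) (q v : 'rV[R]_(4 + 4)) :
  M q -> (forall j, differentiable (phi j) (base_pt q)) ->
  (\forall r \near q, M r <-> forall j, vcoord r j = phi j (base_pt r)) ->
  tangent M q v <->
  forall j, vcoord v j = 'd (phi j) (base_pt q) (base_pt v).
Proof.
move=> Mq dphi Mgraph.
have base_derive (c : R -> 'rV[R]_(4 + 4)) (w : 'rV[R]_(4 + 4)) :
    is_derive (0 : R) 1 c w ->
    is_derive (0 : R) 1 (fun t => base_pt (c t)) (base_pt w).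
  move=> /is_derive_mxP dc; apply/is_derive_mxP => i j.
  rewrite {i}(ord1 i) base_ptE.
  have -> : (fun t => base_pt (c t) 0 j) = fun t => c t 0 _ :=
    funext (fun t => base_ptE (c t) j).
  exact: dc.
split=> [[c [c0 Mc dc]] j|v_tangent].
  have dphic := is_derive_comp_diff (phi j) _ _ _ (base_derive _ _ dc).
  rewrite /= c0 in dphic.
  rewrite -(@derive_val _ _ _ _ _ _ _ (dphic (dphi j))).
  have := (is_derive_mxP _ _ _ _).1 dc 0 (rshift 4 (lift ord0 j)).
  move=> [_]; rewrite vcoordE => <-; apply: near_eq_derive.
  (* The graph equations describe [M] only near [q]; continuity brings the curve there for small
     times. *)
  have ccont : c t @[t --> (0 : R)] --> q.
    rewrite -c0; apply: differentiable_continuous.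
    by case: dc => /derivable1_diffP.
  near=> t.
  have : M (c t) by near: t.
  have -> : M (c t) <-> forall j, vcoord (c t) j = phi j (base_pt (c t)).
    by near: t; exact: ccont Mgraph.
  by move=> /(_ j); rewrite vcoordE.
pose line (t : R) : 'rV[R]_(4 + 4) := q + t *: v.
have dline : is_derive (0 : R) 1 line v.
  apply/is_derive_mxP => i j; under eq_fun do rewrite !mxE.
  by apply: is_derive_eq; rewrite scaler0 !add0r mul1r; exact: mulr1.
have line0 : line 0 = q by rewrite /line scale0r addr0.
have graph_line0 : graph_pt phi (line 0) = q.
  by rewrite line0 graph_pt_id //; exact: (nbhs_singleton Mgraph).1.
have dgraph : is_derive (0 : R) 1 (graph_pt phi \o line) v.
  apply/is_derive_mxP => i k; rewrite {i}(ord1 i) /=.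
  have dlinek := (is_derive_mxP _ _ _ _).1 dline 0 k.
  (* The entries [x], [u] and then [y] are those of the line; only the [v_j] need the chain rule. *)
  have [k' kE|k' kE] := split_ordP k.
    rewrite (_ : (fun t => _) = fun t => line t 0 k) //.
    by apply/funext => t; rewrite kE row_mxEl mxE.
  have [j k'E|k'0] := unliftP ord0 k'; last first.
    rewrite (_ : (fun t => _) = fun t => line t 0 k) //.
    by apply/funext => t; rewrite kE k'0 row_mxEr mxE unlift_none /ycoord mxE.
  rewrite kE k'E -vcoordE v_tangent -line0.
  rewrite (_ : (fun t => _) = phi j \o (fun t => base_pt (line t))).
    apply: (is_derive_comp_diff (phi j) _ _ _ (base_derive _ _ dline)).
    by rewrite line0; exact: dphi.
  by apply/funext => t; rewrite -vcoordE vcoord_graph_pt.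
exists (graph_pt phi \o line); split => //=.
have gcont : (graph_pt phi \o line) t @[t --> (0 : R)] --> q.
  have gc : {for (0 : R), continuous (graph_pt phi \o line)}.
    by apply: differentiable_continuous; case: dgraph => /derivable1_diffP.
  by move: gc; rewrite /prop_for /continuous_at /= graph_line0.
near=> t.
have -> : M (graph_pt phi (line t)) <-> forall j,
    vcoord (graph_pt phi (line t)) j = phi j (base_pt (graph_pt phi (line t))).
  by near: t; exact: gcont Mgraph.
by move=> j; rewrite vcoord_graph_pt base_graph_pt.
Unshelve. all: by end_near. Qed.

(** * Cramer's rule for the tangency equations, in real and imaginary parts *)

Lemma forall_ord3 (P : 'I_3 -> Prop) :
  P 0 -> P 1 -> P 2 -> forall j, P j.
Proof.
move=> P0 P1 P2 [[|[|[|//]]] lt_j].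
- by rewrite (_ : Ordinal lt_j = 0) //; apply: val_inj.
- by rewrite (_ : Ordinal lt_j = 1) //; apply: val_inj.
- by rewrite (_ : Ordinal lt_j = 2) //; apply: val_inj.
Qed.

Lemma sum_ord3 {V : zmodType} (F : 'I_3 -> V) :
  \sum_(j < 3) F j = F 0 + F 1 + F 2.
Proof.
rewrite !big_ord_recl big_ord0 addr0 addrA.
by congr (_ + F _ + F _); apply: val_inj.
Qed.

Lemma sum_ord5 {V : zmodType} (F : 'I_5 -> V) :
  \sum_(k < 5) F k = F 0 + F 1 + F 2 + F 3 + F 4.
Proof.
rewrite !big_ord_recl big_ord0 addr0 !addrA.
by congr (_ + F _ + F _ + F _ + F _); apply: val_inj.
Qed.

Section CramersRule.
Context {R : realType} (phi : 'I_3 -> 'rV[R]_5 -> R) (p : 'rV[R]_5).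
Context (a0 b0 : R) (a b : 'I_3 -> R).

Local Notation f := (partial phi p).
Local Notation D1 := (sigma phi p).
Local Notation D2 := (tau phi p).

(* Real and imaginary parts of [Phi c' + c_0 g - i c'], for [c_0 = a0 + i b0] and
   [c' = a + i b]; below, those of [(sigma + i tau) c' - c_0 (X + i Y)]. *)
Definition cr_re (k : 'I_3) : R := f k 0 * a0 - f k 1 * b0
  + (f k 2 * a 0 + f k 3 * a 1 + f k 4 * a 2) + b k.
Definition cr_im (k : 'I_3) : R := f k 0 * b0 + f k 1 * a0
  + (f k 2 * b 0 + f k 3 * b 1 + f k 4 * b 2) - a k.
Definition cramer_re (k : 'I_3) : R := D1 * a k - D2 * b k
  - (X phi p k * a0 - Y phi p k * b0).
Definition cramer_im (k : 'I_3) : R := D2 * a k + D1 * b k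
  - (Y phi p k * a0 + X phi p k * b0).

(* Naming the entries keeps [ring] from unfolding [partial] when comparing atoms. *)
Local Ltac ring_entries :=
  generalize (f 0 0), (f 0 1), (f 0 2), (f 0 3), (f 0 4),
    (f 1 0), (f 1 1), (f 1 2), (f 1 3), (f 1 4),
    (f 2 0), (f 2 1), (f 2 2), (f 2 3), (f 2 4),
    (a 0), (a 1), (a 2), (b 0), (b 1), (b 2);
  clear; intros; ring.

(* [adj (i I - Phi) = (adj Phi - I) + i (Phi - (tr Phi) I)]; each transitivity
   below is the real or imaginary part of one row of
   [adj (i I - Phi) ((i I - Phi) c' - c_0 g)]. *)
Lemma cramer_solve : (forall k, cr_re k = 0) -> (forall k, cr_im k = 0) ->
  forall k, cramer_re k = 0 /\ cramer_im k = 0.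
Proof.
move=> er ei.
apply: forall_ord3; split.
- transitivity (- ((f 1 3 * f 2 4 - f 1 4 * f 2 3 - 1) * cr_re 0
      + (f 2 3 * f 0 4 - f 2 4 * f 0 3) * cr_re 1
      + (f 0 3 * f 1 4 - f 0 4 * f 1 3) * cr_re 2)
      + ((- f 1 3 - f 2 4) * cr_im 0 + f 0 3 * cr_im 1 + f 0 4 * cr_im 2)).
    by rewrite /cramer_re /cr_re /cr_im /X /Y /= /sigma /tau /X1 /Y1; ring_entries.
  by rewrite !er !ei !(mulr0, addr0, oppr0).
- transitivity (- ((f 1 3 * f 2 4 - f 1 4 * f 2 3 - 1) * cr_im 0
      + (f 2 3 * f 0 4 - f 2 4 * f 0 3) * cr_im 1
      + (f 0 3 * f 1 4 - f 0 4 * f 1 3) * cr_im 2)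
      - ((- f 1 3 - f 2 4) * cr_re 0 + f 0 3 * cr_re 1 + f 0 4 * cr_re 2)).
    by rewrite /cramer_im /cr_re /cr_im /X /Y /= /sigma /tau /X1 /Y1; ring_entries.
  by rewrite !er !ei !(mulr0, addr0, oppr0).
- transitivity (- ((f 1 4 * f 2 2 - f 1 2 * f 2 4) * cr_re 0
      + (f 2 4 * f 0 2 - f 2 2 * f 0 4 - 1) * cr_re 1
      + (f 0 4 * f 1 2 - f 0 2 * f 1 4) * cr_re 2)
      + (f 1 2 * cr_im 0 + (- f 0 2 - f 2 4) * cr_im 1 + f 1 4 * cr_im 2)).
    by rewrite /cramer_re /cr_re /cr_im /X /Y /= /sigma /tau /X2 /Y2; ring_entries.
  by rewrite !er !ei !(mulr0, addr0, oppr0).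
- transitivity (- ((f 1 4 * f 2 2 - f 1 2 * f 2 4) * cr_im 0
      + (f 2 4 * f 0 2 - f 2 2 * f 0 4 - 1) * cr_im 1
      + (f 0 4 * f 1 2 - f 0 2 * f 1 4) * cr_im 2)
      - (f 1 2 * cr_re 0 + (- f 0 2 - f 2 4) * cr_re 1 + f 1 4 * cr_re 2)).
    by rewrite /cramer_im /cr_re /cr_im /X /Y /= /sigma /tau /X2 /Y2; ring_entries.
  by rewrite !er !ei !(mulr0, addr0, oppr0).
- transitivity (- ((f 1 2 * f 2 3 - f 1 3 * f 2 2) * cr_re 0
      + (f 2 2 * f 0 3 - f 2 3 * f 0 2) * cr_re 1
      + (f 0 2 * f 1 3 - f 0 3 * f 1 2 - 1) * cr_re 2)
      + (f 2 2 * cr_im 0 + f 2 3 * cr_im 1 + (- f 0 2 - f 1 3) * cr_im 2)).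
    by rewrite /cramer_re /cr_re /cr_im /X /Y /= /sigma /tau /X3 /Y3; ring_entries.
  by rewrite !er !ei !(mulr0, addr0, oppr0).
- transitivity (- ((f 1 2 * f 2 3 - f 1 3 * f 2 2) * cr_im 0
      + (f 2 2 * f 0 3 - f 2 3 * f 0 2) * cr_im 1
      + (f 0 2 * f 1 3 - f 0 3 * f 1 2 - 1) * cr_im 2)
      - (f 2 2 * cr_re 0 + f 2 3 * cr_re 1 + (- f 0 2 - f 1 3) * cr_re 2)).
    by rewrite /cramer_im /cr_re /cr_im /X /Y /= /sigma /tau /X3 /Y3; ring_entries.
  by rewrite !er !ei !(mulr0, addr0, oppr0).
Qed.

(** With [u = (sigma + i tau) c' - c_0 (X + i Y)], the identity [(i I - Phi) (X + i Y) = (sigma + i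
    tau) g] turns [sigma + i tau] times the left side of the system into [Phi u - i u], which
    vanishes with [u]. *)
Lemma cramer_check : Delta phi p != 0 -> (forall k, cramer_re k = 0) ->
  (forall k, cramer_im k = 0) -> forall k, cr_re k = 0 /\ cr_im k = 0.
Proof.
move=> Delta0 ur ui k.
have re0 : D1 * cr_re k - D2 * cr_im k =
    f k 2 * cramer_re 0 + f k 3 * cramer_re 1 + f k 4 * cramer_re 2 + cramer_im k.
  elim/forall_ord3: k;
    rewrite /cramer_re /cramer_im /cr_re /cr_im /X /Y /= /sigma /tau.
  - by rewrite /X1 /Y1 /X2 /Y2 /X3 /Y3; ring_entries.
  - by rewrite /X1 /Y1 /X2 /Y2 /X3 /Y3; ring_entries.
  - by rewrite /X1 /Y1 /X2 /Y2 /X3 /Y3; ring_entries.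
have im0 : D2 * cr_re k + D1 * cr_im k =
    f k 2 * cramer_im 0 + f k 3 * cramer_im 1 + f k 4 * cramer_im 2 - cramer_re k.
  elim/forall_ord3: k {re0};
    rewrite /cramer_re /cramer_im /cr_re /cr_im /X /Y /= /sigma /tau.
  - by rewrite /X1 /Y1 /X2 /Y2 /X3 /Y3; ring_entries.
  - by rewrite /X1 /Y1 /X2 /Y2 /X3 /Y3; ring_entries.
  - by rewrite /X1 /Y1 /X2 /Y2 /X3 /Y3; ring_entries.
move: re0 im0; rewrite !ur !ui !mulr0 !addr0 subr0 => re0 im0.
(* Multiplying by the conjugate [sigma - i tau] isolates each part with factor [Delta]. *)
split; apply: (mulfI Delta0); rewrite mulr0 /Delta.
- transitivity (D1 * (D1 * cr_re k - D2 * cr_im k)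
      + D2 * (D2 * cr_re k + D1 * cr_im k)).
    by ring.
  by rewrite re0 im0 !mulr0 addr0.
- transitivity (D1 * (D2 * cr_re k + D1 * cr_im k)
      - D2 * (D1 * cr_re k - D2 * cr_im k)).
    by ring.
  by rewrite re0 im0 !mulr0 subr0.
Qed.

(** Since [1 / (sigma + i tau) = (sigma - i tau) / Delta], [Lambda1] and [Lambda2] are the real and
    imaginary parts of [(X + i Y) (sigma - i tau)]. *)
Lemma cr_equations_solution : Delta phi p != 0 ->
  (forall k, cr_re k = 0 /\ cr_im k = 0) <->
  (forall k, (a k +i* b k)%C = (a0 +i* b0)%C * Acoef phi p k).
Proof.
move=> Delta0.
have AcoefE k : Acoef phi p k =
    (Lambda1 phi p k / Delta phi p +i* (Lambda2 phi p k / Delta phi p))%C.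
  by rewrite /Acoef -complexiE [RHS]complexE.
split=> [E k|A].
  have [re0 im0] : cramer_re k = 0 /\ cramer_im k = 0.
    by apply: cramer_solve => l; have [] := E l.
  rewrite AcoefE; apply/eqP; rewrite eq_complex /=.
  (* The conjugate is applied to [(sigma + i tau) c' - c_0 (X + i Y) = 0]. *)
  apply/andP; split; apply/eqP; apply: (mulfI Delta0).
  - transitivity (D1 * cramer_re k + D2 * cramer_im k +
        (Lambda1 phi p k * a0 - Lambda2 phi p k * b0)).
      rewrite /cramer_re /cramer_im /Delta /Lambda1 /Lambda2; ring.
    by rewrite re0 im0 !mulr0 !add0r; field.
  - transitivity (D1 * cramer_im k - D2 * cramer_re k +
        (Lambda1 phi p k * b0 + Lambda2 phi p k * a0)).
      rewrite /cramer_re /cramer_im /Delta /Lambda1 /Lambda2; ring.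
    by rewrite re0 im0 !mulr0 subrr add0r; field.
have aE k : a k = (a0 * Lambda1 phi p k - b0 * Lambda2 phi p k) / Delta phi p.
  by have := congr1 (@complex.Re R) (A k); rewrite AcoefE /= => ->; field.
have bE k : b k = (a0 * Lambda2 phi p k + b0 * Lambda1 phi p k) / Delta phi p.
  by have := congr1 (@complex.Im R) (A k); rewrite AcoefE /= => ->; field.
apply: cramer_check => // k.
- rewrite /cramer_re aE bE; move: Delta0.
  by rewrite /Lambda1 /Lambda2 /Delta => Delta0; field.
- rewrite /cramer_im aE bE; move: Delta0.
  by rewrite /Lambda1 /Lambda2 /Delta => Delta0; field.
Qed.

End CramersRule.

(** * Limits at the origin *)

(** Every term of [tau] other than [-1] is a product of two partial derivatives. *)
Lemma cvg_tau {R : realType} {T : Type} (F : set_system T) {FF : Filter F}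
    (phi : 'I_3 -> 'rV[R]_5 -> R) (u : T -> 'rV[R]_5) :
  (forall j k, partial phi (u t) j k @[t --> F] --> (0 : R)) ->
  tau phi (u t) @[t --> F] --> (-1 : R).
Proof.
move=> partial0.
have mul0 j k j' k' :
    partial phi (u t) j k * partial phi (u t) j' k' @[t --> F] --> (0 : R).
  by rewrite -[X in _ --> X](mulr0 0); exact: cvgM.
have -> : -1 = -1 + 0 - 0 - 0 + 0 - 0 + 0 :> R by ring.
rewrite /tau; apply: cvgD => //; apply: cvgB => //; apply: cvgD => //.
apply: cvgB => //; apply: cvgB => //; apply: cvgD => //; exact: cvg_cst.
Qed.

Lemma cvg_base_pt {R : realType} :
  base_pt q @[q --> (0 : 'rV[R]_(4 + 4))] --> (0 : 'rV[R]_5).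
Proof.
apply/(@cvgrPdist_lt _ _ _ (nbhs (0 : 'rV[R]_(4 + 4)))) => e e0; near=> q.
rewrite sub0r normrN; apply: (@le_lt_trans _ _ `|q|); last first.
  by near: q; exact: (@nbhs0_lt _ 'rV[R]_(4 + 4)).
rewrite [leLHS]/Num.Def.normr /= mx_normrE; apply: bigmax_le => // -[i k] _.
by rewrite /= (ord1 i) base_ptE; exact: ler_coord_norm.
Unshelve. all: by end_near. Qed.

(** * The fibres of [T01] on a graph *)

Lemma diff_partial {R : realType} (phi : 'I_3 -> 'rV[R]_5 -> R) (j : 'I_3)
    (p w : 'rV[R]_5) : differentiable (phi j) p ->
  'd (phi j) p w = \sum_(k < 5) partial phi p j k * w 0 k.
Proof.
move=> dphi; rewrite {1}[w]row_sum_delta linear_sum; apply: eq_bigr => k _.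
by rewrite linearZ /partial deriveE // mulrC.
Qed.

(** Real vectors [a] and [b] are determined by [a + i b], so complex tangency amounts to two real
    tangencies. *)
Lemma ctangentP {R : realType} {n : nat} (M : set 'rV[R]_n) (p : 'rV[R]_n)
    (V : 'rV[R[i]]_n) :
  ctangent M p V <->
  tangent M p (map_mx (@complex.Re R) V) /\ tangent M p (map_mx (@complex.Im R) V).
Proof.
split=> [[a [b [Ma Mb ->]]]|[Ma Mb]].
  rewrite (_ : map_mx (@complex.Re R) _ = a); last first.
    by apply/rowP => k; rewrite !mxE -complexiE /=; ring.
  rewrite (_ : map_mx (@complex.Im R) _ = b) //.
  by apply/rowP => k; rewrite !mxE -complexiE /=; ring.
exists (map_mx (@complex.Re R) V), (map_mx (@complex.Im R) V); split => //.
by apply/rowP => k; rewrite !mxE -complexiE; exact: complexE.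
Qed.

Lemma sum_dbarE {R : realType} {n : nat} (c : 'I_n -> R[i]) :
  \sum_(k < n) c k *: dbar R k =
  row_mx (\row_k (c k / 2)) (\row_k ('i * c k / 2)).
Proof.
pose e (k : 'I_n) : 'rV[R[i]]_n := delta_mx 0 k.
have -> : \sum_(k < n) c k *: dbar R k =
    row_mx (2^-1 *: \sum_(k < n) c k *: e k)
      ((2^-1 * 'i) *: \sum_(k < n) c k *: e k).
  rewrite -[LHS]hsubmxK; congr row_mx.
    rewrite linear_sum scaler_sumr; apply: eq_bigr => k _ /=.
    by rewrite /dbar !linearZ linearD linearZ /= !row_mxKl scaler0 addr0
      !scalerA mulrC.
  rewrite linear_sum scaler_sumr; apply: eq_bigr => k _ /=.
  rewrite /dbar !linearZ linearD linearZ /= !row_mxKr add0r.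
  by rewrite !scalerA; congr (_ *: _); ring.
have -> : \sum_(k < n) c k *: e k = \row_k c k.
  by rewrite [RHS]row_sum_delta; apply: eq_bigr => k _; rewrite mxE.
by congr row_mx; apply/rowP => k; rewrite !mxE; ring.
Qed.

(** [tangent_graph] is applied to the real and imaginary parts of the vector, which yields those of
    [Phi c' + c_0 g - i c' = 0]. *)
Lemma ctangent_graph {R : realType} (M : set 'rV[R]_(4 + 4))
    (phi : 'I_3 -> 'rV[R]_5 -> R) (q : 'rV[R]_(4 + 4)) (c : 'I_4 -> R[i]) :
  M q -> (forall j, differentiable (phi j) (base_pt q)) ->
  (\forall r \near q, M r <-> forall j, vcoord r j = phi j (base_pt r)) ->
  let a k := complex.Re (c (lift ord0 k)) in
  let b k := complex.Im (c (lift ord0 k)) in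
  let a0 := complex.Re (c ord0) in
  let b0 := complex.Im (c ord0) in
  ctangent M q (\sum_(k < 4) c k *: dbar R k) <->
  forall k, cr_re phi (base_pt q) a0 b0 a b k = 0 /\
            cr_im phi (base_pt q) a0 b0 a b k = 0.
Proof.
move=> Mq dphi Mgraph a b a0 b0.
have half : 2^-1 = (2^-1)%:C%C :> R[i].
  by rewrite rmorphV ?unitfE // rmorph_nat.
set W := \sum_(k < 4) _.
have Re_half (z : R[i]) : complex.Re (z / 2) = complex.Re z / 2.
  by rewrite half; case: z => x y /=; ring.
have Im_half (z : R[i]) : complex.Im (z / 2) = complex.Im z / 2.
  by rewrite half; case: z => x y /=; ring.
have Re_i (z : R[i]) : complex.Re ('i * z) = - complex.Im z.
  by rewrite -complexiE; case: z => x y /=; ring.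
have Im_i (z : R[i]) : complex.Im ('i * z) = complex.Re z.
  by rewrite -complexiE; case: z => x y /=; ring.
(* The entries over [x], [y], [u], [v] are the real parts of [c_0 / 2], [i c_0 / 2], [c' / 2],
   [i c' / 2]; the factor 1/2 comes from [dbar]. *)
have reE j : 'd (phi j) (base_pt q) (base_pt (map_mx (@complex.Re R) W)) -
    vcoord (map_mx (@complex.Re R) W) j = cr_re phi (base_pt q) a0 b0 a b j / 2.
  rewrite diff_partial // sum_ord5 vcoordE !base_ptE /= !mxE /W sum_dbarE.
  rewrite !(row_mxEl, row_mxEr) !mxE !(Re_half, Re_i) /cr_re /a /b /a0 /b0.
  by move: (partial phi (base_pt q)) => g; field.
have imE j : 'd (phi j) (base_pt q) (base_pt (map_mx (@complex.Im R) W)) -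
    vcoord (map_mx (@complex.Im R) W) j = cr_im phi (base_pt q) a0 b0 a b j / 2.
  rewrite diff_partial // sum_ord5 vcoordE !base_ptE /= !mxE /W sum_dbarE.
  rewrite !(row_mxEl, row_mxEr) !mxE !(Im_half, Im_i) /cr_im /a /b /a0 /b0.
  by move: (partial phi (base_pt q)) => g; field.
have half_eq0 (x y z : R) : x - y = z / 2 -> (y = x <-> z = 0).
  by move=> E; split=> H; lra.
rewrite ctangentP !(tangent_graph _ _ _ _ Mq dphi Mgraph).
split=> [[tre tim] k|E].
  by split; [apply/(half_eq0 _ _ _ (reE k))|apply/(half_eq0 _ _ _ (imE k))].
split=> k; have [re0 im0] := E k.
  exact/(half_eq0 _ _ _ (reE k)).
exact/(half_eq0 _ _ _ (imE k)).
Qed.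

Lemma Lbar_sum {R : realType} (phi : 'I_3 -> 'rV[R]_5 -> R) (p : 'rV[R]_5)
    (c : 'I_4 -> R[i]) :
  (forall j, c (lift ord0 j) = c ord0 * Acoef phi p j) ->
  \sum_(k < 4) c k *: dbar R k = c ord0 *: Lbar phi p.
Proof.
move=> cA; rewrite big_ord_recl /Lbar scalerDr scaler_sumr; congr (_ + _).
by apply: eq_bigr => j _; rewrite cA scalerA.
Qed.

(** Tangency leaves [c_0] free and forces [c' = c_0 A], so the fibre is the complex line through
    [Lbar]. *)
Lemma T01_graph {R : realType} (M : set 'rV[R]_(4 + 4))
    (phi : 'I_3 -> 'rV[R]_5 -> R) (q : 'rV[R]_(4 + 4)) :
  M q -> (forall j, differentiable (phi j) (base_pt q)) ->
  (\forall r \near q, M r <-> forall j, vcoord r j = phi j (base_pt r)) ->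
  Delta phi (base_pt q) != 0 ->
  T01 M q = [set c *: Lbar phi (base_pt q) | c in [set: R[i]]].
Proof.
move=> Mq dphi Mgraph Delta0.
have ctangentE (c : 'I_4 -> R[i]) :
    ctangent M q (\sum_(k < 4) c k *: dbar R k) <->
    forall j, c (lift ord0 j) = c ord0 * Acoef phi (base_pt q) j.
  apply: (iff_trans (ctangent_graph _ _ _ _ Mq dphi Mgraph)).
  apply: (iff_trans (cr_equations_solution _ _ _ _ _ _ Delta0)).
  have eta (z : R[i]) : (complex.Re z +i* complex.Im z)%C = z by case: z.
  by split=> + j => /(_ j); rewrite !eta.
apply/seteqP; split=> [V [[c ->] /ctangentE cA]|_ [c _ <-]].
  by exists (c ord0) => //; rewrite (Lbar_sum phi (base_pt q)).
pose coef (k : 'I_4) := if unlift ord0 k is Some j then c * Acoef phi (base_pt q) j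
                        else c.
have coef0 : coef ord0 = c by rewrite /coef unlift_none.
have coefA j : coef (lift ord0 j) = coef ord0 * Acoef phi (base_pt q) j.
  by rewrite coef0 /coef liftK.
rewrite -{1}coef0 -(Lbar_sum _ _ _ coefA); split; first by exists coef.
exact/ctangentE.
Qed.

Theorem proposition1p4 (R : realType) (M : set 'rV[R[i]]_4)
    (phi : 'I_3 -> 'rV[R]_5 -> R)
    (M_submanifold : @analytic_submanifold R (4 + 4) 3 (realify M))
    (M_generic : CR_generic (realify M))
    (phi_analytic : forall j, analytic_near (phi j) 0)
    (phi0 : forall j, phi j 0 = 0)
    (dphi0 : forall j v, 'd (phi j) (0 : 'rV[R]_5) v = 0)
    (M_graph : \forall q \near (0 : 'rV[R]_(4 + 4)),
       M (complex_pt q) <-> forall j, vcoord q j = phi j (base_pt q)) :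
  \forall q \near (0 : 'rV[R]_(4 + 4)), M (complex_pt q) ->
    Delta phi (base_pt q) != 0 /\
    T01 (realify M) q = [set c *: Lbar phi (base_pt q) | c in [set: R[i]]].
Proof.
have cvg_partial j k :
    partial phi (base_pt q) j k @[q --> (0 : 'rV[R]_(4 + 4))] --> (0 : R).
  have [dphi _] := analytic_at_differentiable (nbhs_singleton (phi_analytic j)).
  have := analytic_near_derive_continuous (delta_mx 0 k) (phi_analytic j).
  rewrite deriveE // dphi0; exact: cvg_comp cvg_base_pt.
(* A negative [tau] makes [Delta], a sum of two squares, positive. *)
have tau_lt0 : \forall q \near (0 : 'rV[R]_(4 + 4)), tau phi (base_pt q) < 0.
  exact: (cvgr_lt _ (cvg_tau _ _ _ cvg_partial) _ (@ltrN10 R)).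
near=> q => Mq.
have Delta0 : Delta phi (base_pt q) != 0.
  rewrite gt_eqF // ltr_wpDl ?sqr_ge0 // exprn_even_gt0 //= lt_eqF //.
  by near: q.
split=> //; apply: T01_graph => // [j|].
  have : forall i, differentiable (phi i) (base_pt q).
    near: q; apply: filter_forall => i.
    apply: (cvg_base_pt [set p | differentiable (phi i) p]); near=> p => /=.
    suff /analytic_at_differentiable[] : analytic_at (phi i) p by [].
    by near: p; exact: phi_analytic.
  by apply.
(* A property that holds near 0 holds near every point close to 0. *)
by near: q; exact: nbhs_interior.
Unshelve. all: by end_near. Qed.
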